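(* Let $X$ be a shift space. Then $G(B^{\mathrm{lc}}(X))\cong G^{\mathrm{lc}}(X,\sigma)$ as topological (étale) groupoids.
   Context: **Shift spaces.** A shift space is a closed, shift-invariant subset $X\subseteq\mathcal A^{\mathbb Z}$ ($\mathcal A$ a finite alphabet), with shift map $\sigma(x)_i=x_{i+1}$. $\mathcal L(X)$ is the set of finite words (including the empty word) occurring in elements of $X$, and $\mathcal L_n(X)$ the set of those of length $n$. The metric is $d(x,y)=\inf_{n\ge1}\{2^{-n}: x_i=y_i \text{ for all } |i|<n\}$ if $x_0=y_0$, and $d(x,y)=1$ otherwise. The context of $w\in\mathcal L(X)$ is $E(w)=\{(a,b)\in\mathcal L(X)\times\mathcal L(X): awb\in\mathcal L(X)\}$. Words $w,v$ of the same length are context equivalent, $w\sim v$, if $E(w)=E(v)$; $[w]$ is the class of $w$. **Local conjugacy groupoid.** $x\sim_{\mathrm{lc}}y$ if there are open neighbourhoods $U\ni x$, $V\ni y$ in $X$ and a homeomorphism $\gamma:U\to V$ with $\gamma(x)=y$ and $\lim_{n\to\pm\infty}\sup_{z\in U}d(\sigma^n(z),\sigma^n(\gamma(z)))=0$ (a local conjugacy). $G^{\mathrm{lc}}(X,\sigma)=\{(x,y)\in X\times X:x\sim_{\mathrm{lc}}y\}$, an étale groupoid (equivalence relation) with topology having basis the sets $\{(z,\gamma(z)):z\in U\}$ for local conjugacies $\gamma:U\to V$. **Groupoid of a Bratteli diagram.** A Bratteli diagram $B=(V,E)$ consists of finite vertex sets $V_n$ and finite edge sets $E_n$, $n\ge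 N$, with each $e\in E_n$ having initial vertex $i(e)\in V_n$ and terminal vertex $t(e)\in V_{n+1}$ (multiple edges allowed). $B^\infty=\{(e_N,e_{N+1},\dots): e_n\in E_n,\ t(e_n)=i(e_{n+1})\}$, with the topology from $\prod_n E_n$. $G(B)=\{(e,e')\in B^\infty\times B^\infty:\exists M\ge N,\ e_n=e_n'\ \forall n>M\}$, with topology having basis the sets $\Gamma(e,e',M)=\{(f,(e'_N,\dots,e'_M,f_{M+1},\dots)): f\in B^\infty,\ f_n=e_n\ \forall N\le n\le M\}$, for $(e,e')\in G(B)$ and $M$ with $e_n=e'_n$ for all $n>M$. **The diagram $B^{\mathrm{lc}}(X)$.** Indices start at $-1$. $V_{-1}=\{*\}$, and $V_n=\mathcal L_{2n+1}(X)/\!\sim$ for $n\ge0$. There is one edge in $E_{-1}$ from $*$ to $[a]$ for each letter $a\in\mathcal L_1(X)$. For $n\ge0$, for each $[w]\in V_n$ and each pair of letters $(a,b)\in E(w)$ there is one edge in $E_n$, labelled $(a,b)$, from $[w]$ to $[awb]$ (well defined on classes). *)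

(* Defs.v *)
From HB Require Import structures.
From mathcomp Require Import all_boot all_order all_algebra.
From mathcomp Require Import all_classical all_reals.
From mathcomp Require Import interval_inference topology normedtype sequences.
From mathcomp Require Import zify.

Set Implicit Arguments.
Unset Strict Implicit.
Unset Printing Implicit Defensive.

Import Order.TTheory GRing.Theory Num.Theory.
Import numFieldNormedType.Exports.

Local Open Scope classical_set_scope.
Local Open Scope ring_scope.

(* [mul g h] is only meaningful when [composable g h].  The last field says
   that the range map [g |-> g g^-1] is a local homeomorphism. *)
Record etaleGroupoid := EtaleGroupoid {
  arrow :> topologicalType;
  composable : arrow -> arrow -> Prop;
  mul : arrow -> arrow -> arrow;
  inv : arrow -> arrow;
  invK : forall g, inv (inv g) = g;
  composableMl : forall g h k,
    composable g h -> composable h k -> composable (mul g h) k;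
  composableMr : forall g h k,
    composable g h -> composable h k -> composable g (mul h k);
  mulA : forall g h k, composable g h -> composable h k ->
    mul (mul g h) k = mul g (mul h k);
  composableV : forall g, composable g (inv g);
  mulKg : forall g h, composable g h -> mul (inv g) (mul g h) = h;
  mulgK : forall g h, composable g h -> mul (mul g h) (inv h) = g;
  inv_continuous : continuous inv;
  mul_continuous : {within [set p : arrow * arrow | composable p.1 p.2],
    continuous (fun p => mul p.1 p.2)};
  range_local_homeo : forall g, exists W : set arrow, [/\ open W, W g,
    {in W &, injective (fun h => mul h (inv h))} &
    forall O, open O -> O `<=` W -> open [set mul h (inv h) | h in O]]
}.

Definition groupoid_isomorphic (G H : etaleGroupoid) : Prop :=
  exists (f : G -> H) (f' : H -> G),
    [/\ cancel f f', cancel f' f, continuous f, continuous f' &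
     (forall g h, composable g h <-> composable (f g) (f h)) /\
     (forall g h, composable g h -> f (mul g h) = mul (f g) (f h))].

(* An equivalence relation, viewed as a groupoid of pairs, together with a
   family of subsets of its graph that is the basis of an etale topology. *)
Record etaleEqrel (T : choiceType) := EtaleEqrel {
  er_rel : T -> T -> Prop;
  er_base : set (set (T * T));
  er_refl : forall x, er_rel x x;
  er_sym : forall x y, er_rel x y -> er_rel y x;
  er_trans : forall x y z, er_rel x y -> er_rel y z -> er_rel x z;
  er_sub : forall B, er_base B -> B `<=` [set p | er_rel p.1 p.2];
  er_cover : forall p, er_rel p.1 p.2 -> exists2 B, er_base B & B p;
  er_join : forall B C p, er_base B -> er_base C -> B p -> C p ->
    exists D, [/\ er_base D, D p & D `<=` B `&` C];
  er_inv : forall B x y, er_base B -> B (x, y) ->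
    exists C, [/\ er_base C, C (y, x) & forall z t, C (z, t) -> B (t, z)];
  er_mul : forall B x y z, er_base B -> er_rel x y -> er_rel y z -> B (x, z) ->
    exists C D, [/\ er_base C, er_base D, C (x, y), D (y, z) &
      forall x' y' z', C (x', y') -> D (y', z') -> B (x', z')];
  er_inj : forall B x y z, er_base B -> B (x, y) -> B (x, z) -> y = z;
  er_unit : forall B x y, er_base B -> B (x, y) ->
    exists C, [/\ er_base C, C (x, x) &
      forall z t, C (z, t) -> z = t /\ exists u, B (z, u)]
}.

Section GroupoidOfEqrel.
Context {T : choiceType} (E : etaleEqrel T).

Definition er_arrow : Type := set_type [set p : T * T | er_rel E p.1 p.2].

HB.instance Definition _ := Choice.on er_arrow.

Definition er_open_base (B : set (T * T)) : set er_arrow := val @^-1` B.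

Lemma er_arrowP (g : er_arrow) : er_rel E (val g).1 (val g).2.
Proof. by have /set_mem := valP g. Qed.

Definition er_mk x y (xy : er_rel E x y) : er_arrow :=
  SigSub (mem_set (xy : [set p : T * T | er_rel E p.1 p.2] (x, y))).

Lemma er_base_cover : \bigcup_(B in er_base E) er_open_base B = setT.
Proof.
apply/seteqP; split => // g _.
by have [B DB Bg] := er_cover (er_arrowP g); exists B.
Qed.

Lemma er_base_join B C (g : er_arrow) : er_base E B -> er_base E C ->
  er_open_base B g -> er_open_base C g ->
  exists D, [/\ er_base E D, er_open_base D g &
    er_open_base D `<=` er_open_base B `&` er_open_base C].
Proof.
move=> DB DC Bg Cg; have [D [DD Dg DBC]] := er_join DB DC Bg Cg.
by exists D; split => // h /DBC.
Qed.

HB.instance Definition _ :=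
  isBaseTopological.Build er_arrow er_base_cover er_base_join.

Lemma er_base_open B : er_base E B -> open (er_open_base B).
Proof.
by move=> DB; exists [set B]; [move=> _ -> | rewrite bigcup_set1].
Qed.

Lemma er_nbhsP (g : er_arrow) (O : set er_arrow) : nbhs g O <->
  exists B, [/\ er_base E B, er_open_base B g & er_open_base B `<=` O].
Proof.
rewrite nbhsE /=; split => [[U [[D sD <-] [B DB Bg]] UO]|[B [DB Bg BO]]].
  by exists B; split => //; [exact: sD | move=> h Bh; apply: UO; exists B].
by exists (er_open_base B) => //; split => //; exact: er_base_open.
Qed.

Definition er_composable (g h : er_arrow) : Prop := (val g).2 = (val h).1.

Definition er_minv (g : er_arrow) : er_arrow := er_mk (er_sym (er_arrowP g)).

Lemma er_compP (g h : er_arrow) : er_composable g h ->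
  er_rel E (val g).1 (val h).2.
Proof.
by move=> gh; apply: er_trans (er_arrowP g) _; rewrite gh; exact: er_arrowP.
Qed.

(* the value [g] on non composable pairs is arbitrary *)
Definition er_mmul (g h : er_arrow) : er_arrow :=
  if pselect (er_composable g h) is left gh then er_mk (er_compP gh) else g.

Lemma er_mmulE g h : er_composable g h ->
  val (er_mmul g h) = ((val g).1, (val h).2).
Proof. by rewrite /er_mmul; case: pselect. Qed.

Fact er_invK g : er_minv (er_minv g) = g.
Proof. by apply: val_inj => /=; rewrite -surjective_pairing. Qed.

Fact er_composableMl g h k : er_composable g h -> er_composable h k ->
  er_composable (er_mmul g h) k.
Proof. by move=> gh hk; rewrite /er_composable er_mmulE. Qed.

Fact er_composableMr g h k : er_composable g h -> er_composable h k ->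
  er_composable g (er_mmul h k).
Proof. by move=> gh hk; rewrite /er_composable er_mmulE. Qed.

Fact er_mulA g h k : er_composable g h -> er_composable h k ->
  er_mmul (er_mmul g h) k = er_mmul g (er_mmul h k).
Proof.
move=> gh hk; apply: val_inj.
have ghk := er_composableMl gh hk; have ghk' := er_composableMr gh hk.
by rewrite !er_mmulE.
Qed.

Fact er_composableV g : er_composable g (er_minv g). Proof. by []. Qed.

Fact er_mulKg g h : er_composable g h -> er_mmul (er_minv g) (er_mmul g h) = h.
Proof.
move=> gh; apply: val_inj; rewrite er_mmulE; last first.
  by rewrite /er_composable er_mmulE.
by rewrite er_mmulE //= gh -surjective_pairing.
Qed.

Fact er_mulgK g h : er_composable g h -> er_mmul (er_mmul g h) (er_minv h) = g.
Proof.
move=> gh; apply: val_inj; rewrite er_mmulE; last first.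
  by rewrite /er_composable er_mmulE.
by rewrite er_mmulE //= -gh -surjective_pairing.
Qed.

Fact er_inv_continuous : continuous er_minv.
Proof.
move=> g O /er_nbhsP[B [DB Bg BO]].
have [C [DC Cg CB]] := er_inv DB Bg.
apply/er_nbhsP; exists C; split => //.
  by rewrite /er_open_base /= (surjective_pairing (val g)) in Cg *.
move=> h Ch; apply: BO; apply: CB.
by rewrite -surjective_pairing.
Qed.

Fact er_mul_continuous :
  {within [set p : er_arrow * er_arrow | er_composable p.1 p.2],
    continuous (fun p => er_mmul p.1 p.2)}.
Proof.
apply/subspace_continuousP => -[g h] /= gh O /er_nbhsP[B [DB Bg BO]].
rewrite /er_open_base /= er_mmulE // in Bg.
have hE : er_rel E (val g).2 (val h).2 by rewrite gh; exact: er_arrowP.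
have [C [D [DC DD Cg Dh CDB]]] := er_mul DB (er_arrowP g) hE Bg.
exists (er_open_base C, er_open_base D) => /=.
  split; apply/er_nbhsP; [exists C|exists D]; split => //.
    by rewrite /er_open_base /= (surjective_pairing (val g)).
  by rewrite /er_open_base /= (surjective_pairing (val h)) -gh.
move=> [g' h'] /= [Cg' Dh'] gh'; apply: BO; rewrite /er_open_base /= er_mmulE //.
by apply: (CDB _ (val g').2); rewrite ?[in X in D X]gh' -surjective_pairing.
Qed.

Fact er_range_local_homeo g : exists W : set er_arrow, [/\ open W, W g,
    {in W &, injective (fun h => er_mmul h (er_minv h))} &
    forall O, open O -> O `<=` W -> open [set er_mmul h (er_minv h) | h in O]].
Proof.
have [B DB Bg] := er_cover (er_arrowP g).
exists (er_open_base B); split => //; first exact: er_base_open.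
  move=> h k /set_mem Bh /set_mem Bk /(congr1 val).
  rewrite !er_mmulE; try exact: er_composableV.
  move=> -[hk _]; apply: val_inj.
  rewrite (surjective_pairing (val h)) (surjective_pairing (val k)) hk.
  congr (_, _); apply: (er_inj (x := (val h).1) DB).
    by rewrite -surjective_pairing.
  by rewrite hk -surjective_pairing.
move=> O oO _; rewrite openE => _ [h Oh <-].
have /er_nbhsP[C [DC Ch CO]] := open_nbhs_nbhs (conj oO Oh).
rewrite /er_open_base /= (surjective_pairing (val h)) in Ch.
have [D [DD Dh DC']] := er_unit DC Ch.
apply/er_nbhsP; exists D; split => //.
  by rewrite /er_open_base /= er_mmulE.
move=> k; rewrite /er_open_base /= (surjective_pairing (val k)).
move=> /DC'[k12 [u Cu]]; exists (er_mk (er_sub DC Cu)); first exact: CO.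
by apply: val_inj; rewrite er_mmulE //= {2}k12 -surjective_pairing.
Qed.

Definition eqrel_groupoid : etaleGroupoid :=
  EtaleGroupoid er_invK er_composableMl er_composableMr er_mulA
    er_composableV er_mulKg er_mulgK er_inv_continuous er_mul_continuous
    er_range_local_homeo.

End GroupoidOfEqrel.

(* Level [k : nat] stands for the index [N + k], where [N] is the first index
   of the diagram. *)
Record bratteli := Bratteli {
  vert : nat -> finType;
  edge : nat -> finType;
  init : forall n, edge n -> vert n;
  term : forall n, edge n -> vert n.+1
}.

Section BratteliGroupoid.
Variable B : bratteli.

Definition paths : set (forall n, edge B n) :=
  [set e : forall n, edge B n | forall n, term (e n) = init (e n.+1)].

Definition path_space : Type := set_type paths.
HB.instance Definition _ := Choice.on path_space.

Implicit Types e f : path_space.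

Definition tail_equiv e f : Prop :=
  exists M, forall n, (M < n)%N -> val e n = val f n.

(* The graph of [f |-> (e'_0, ..., e'_M, f_(M+1), ...)] on the cylinder of the
   paths that agree with [e] up to level [M]. *)
Definition tail_graph e e' M : set (path_space * path_space) :=
  [set p | [/\ forall n, (n <= M)%N -> val p.1 n = val e n,
               forall n, (n <= M)%N -> val p.2 n = val e' n &
               forall n, (M < n)%N -> val p.2 n = val p.1 n]].

Definition tail_base : set (set (path_space * path_space)) :=
  [set G | exists e e' M,
    (forall n, (M < n)%N -> val e n = val e' n) /\ G = tail_graph e e' M].

Lemma path_eq e f : (forall n, val e n = val f n) -> e = f.
Proof. by move=> ef; apply: val_inj; exact: functional_extensionality_dep. Qed.

Lemma tail_graph_mem e e' M : (forall n, (M < n)%N -> val e n = val e' n) ->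
  tail_base (tail_graph e e' M) /\ tail_graph e e' M (e, e').
Proof. by move=> ee'; split; [exists e, e', M | split => // n /ee']. Qed.

Fact tail_refl e : tail_equiv e e. Proof. by exists 0%N. Qed.

Fact tail_sym e f : tail_equiv e f -> tail_equiv f e.
Proof. by move=> [M ef]; exists M => n /ef. Qed.

Fact tail_trans e f g : tail_equiv e f -> tail_equiv f g -> tail_equiv e g.
Proof.
move=> [M ef] [M' fg]; exists (maxn M M') => n.
by rewrite gtn_max => /andP[/ef -> /fg].
Qed.

Fact tail_sub G : tail_base G -> G `<=` [set p | tail_equiv p.1 p.2].
Proof. by move=> [e [e' [M [_ ->]]]] p [_ _ p12]; exists M => n /p12. Qed.

Fact tail_cover p : tail_equiv p.1 p.2 -> exists2 G, tail_base G & G p.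
Proof.
case: p => e e' [M /= ee']; have [] := tail_graph_mem ee'.
by exists (tail_graph e e' M).
Qed.

Fact tail_join G H p : tail_base G -> tail_base H -> G p -> H p ->
  exists D, [/\ tail_base D, D p & D `<=` G `&` H].
Proof.
move=> [e [e' [M [ee' ->]]]] [f [f' [N [ff' ->]]]].
case: p => x y [/= xe ye xy] [/= xf yf xy'].
have xyM n : (maxn M N < n)%N -> val x n = val y n.
  by rewrite gtn_max => /andP[/xy].
have [D1 D2] := tail_graph_mem xyM.
exists (tail_graph x y (maxn M N)); split => //.
move=> [z t] [/= zx ty zt]; split; split => n /= nM.
- by rewrite zx ?xe // leq_max nM.
- by rewrite ty ?ye // leq_max nM.
- have [nM'|/zt //] := leqP n (maxn M N); by rewrite zx // ty // xy.
- by rewrite zx ?xf // leq_max nM orbT.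
- by rewrite ty ?yf // leq_max nM orbT.
- have [nM'|/zt //] := leqP n (maxn M N); by rewrite zx // ty // xy'.
Qed.

Fact tail_inv G x y : tail_base G -> G (x, y) ->
  exists C, [/\ tail_base C, C (y, x) & forall z t, C (z, t) -> G (t, z)].
Proof.
move=> [e [e' [M [ee' ->]]]] [/= xe ye xy]; exists (tail_graph e' e M); split.
- by apply: (tail_graph_mem _).1 => n /ee'.
- by split => //= n /xy.
- by move=> z t [/= ze te zt]; split => //= n /zt.
Qed.

Fact tail_mul G x y z : tail_base G -> tail_equiv x y -> tail_equiv y z ->
  G (x, z) -> exists C D, [/\ tail_base C, tail_base D, C (x, y), D (y, z) &
    forall x' y' z', C (x', y') -> D (y', z') -> G (x', z')].
Proof.
move=> [e [e' [M [ee' ->]]]] [N xy] [N' yz] [/= xe ze xz].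
pose K := maxn M (maxn N N').
have xyK n : (K < n)%N -> val x n = val y n.
  by rewrite !gtn_max => /and3P[_ /xy].
have yzK n : (K < n)%N -> val y n = val z n.
  by rewrite !gtn_max => /and3P[_ _ /yz].
have [C1 C2] := tail_graph_mem xyK; have [D1 D2] := tail_graph_mem yzK.
exists (tail_graph x y K), (tail_graph y z K); split => // x' y' z'.
move=> [/= x'x y'y x'y'] [/= _ z'z y'z']; split => n /= nM.
- by rewrite x'x ?xe // leq_max nM.
- by rewrite z'z ?ze // leq_max nM.
- have [nK|nK] := leqP n K; first by rewrite x'x // z'z // xz.
  by rewrite y'z' // x'y'.
Qed.

Fact tail_inj G x y z : tail_base G -> G (x, y) -> G (x, z) -> y = z.
Proof.
move=> [e [e' [M [ee' ->]]]] [/= _ ye xy] [/= _ ze xz]; apply: path_eq => n /=.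
by have [nM|nM] := leqP n M; [rewrite ye // ze | rewrite xy // xz].
Qed.

Fact tail_unit G x y : tail_base G -> G (x, y) ->
  exists C, [/\ tail_base C, C (x, x) &
    forall z t, C (z, t) -> z = t /\ exists u, G (z, u)].
Proof.
move=> [e [e' [M [ee' ->]]]] [/= xe ye xy].
exists (tail_graph e e M); split.
- by apply: (tail_graph_mem _).1.
- by split.
move=> z t [/= ze te zt]; split.
  apply: path_eq => n /=; have [nM|/zt //] := leqP n M.
  by rewrite ze // te.
have uP : paths (fun n => if (n <= M)%N then val e' n else val z n).
  move=> n /=; have /set_mem zP := valP z; have /set_mem eP' := valP e'.
  have /set_mem eP := valP e.
  have [nM|nM|->] := ltngtP n M.
  - exact: eP'.
  - exact: zP.
  - by rewrite eP' -(ee' M.+1) // -zP -eP /= ze.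
exists (SigSub (mem_set uP)); split => //= n.
  by move=> ->.
by rewrite ltnNge => /negbTE ->.
Qed.

Definition tail_eqrel : etaleEqrel path_space :=
  EtaleEqrel tail_refl tail_sym tail_trans tail_sub tail_cover tail_join
    tail_inv tail_mul tail_inj tail_unit.

Definition bratteli_groupoid : etaleGroupoid := eqrel_groupoid tail_eqrel.

End BratteliGroupoid.

Notation fullshift A := {ptws int -> discrete_topology A}.

(* [shift n] is the n-th iterate of the shift map, for [n : int]. *)
Definition shift {A : finType} (n : int) (x : fullshift A) : fullshift A :=
  fun i => x (i + n).

Definition shift_space {A : finType} (X : set (fullshift A)) : Prop :=
  closed X /\ shift 1 @` X = X.

Definition dist {R : realType} {A : finType} (x y : fullshift A) : R :=
  if x 0 == y 0
  then inf [set 2 ^- n | n in [set n : nat | (1 <= n)%N /\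
                               forall i : int, (`|i| < n)%N -> x i = y i]]
  else 1.

(* [g] restricts to a homeomorphism from [U] onto [V]; its values outside of
   [U] are irrelevant, and so are those of the inverse outside of [V]. *)
Definition homeo_between {T : topologicalType} (U V : set T) (g : T -> T) :
    Prop :=
  [/\ set_bij U V g, {within U, continuous g} &
      exists h : T -> T, (forall x, U x -> h (g x) = x) /\
                         {within V, continuous h}].

Section LocalConjugacy.
Variables (R : realType) (A : finType) (X : set (fullshift A)).
Implicit Types (x y z : X) (U V : set X) (g h : X -> X).

Definition sup_dist U g (n : int) : R :=
  sup [set dist (shift n (val z)) (shift n (val (g z))) | z in U].

Definition local_conjugacy U V g : Prop :=
  [/\ open U, open V, homeo_between U V g,
      sup_dist U g n%:Z @[n --> \oo] --> (0 : R) &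
      sup_dist U g (- n%:Z) @[n --> \oo] --> (0 : R)].

Definition lc_equiv x y : Prop :=
  exists U V g, [/\ U x, V y, local_conjugacy U V g & g x = y].

Definition lc_graph U g : set (X * X) := [set (z, g z) | z in U].

Definition lc_base : set (set (X * X)) :=
  [set B | exists U V g, local_conjugacy U V g /\ B = lc_graph U g].

Lemma dist_ge0 (a b : fullshift A) : 0 <= dist a b :> R.
Proof.
rewrite /dist; case: ifP => // ab; apply: lb_le_inf.
  exists (2 ^- 1), 1%N => //; split => // i.
  by rewrite ltnS leqn0 absz_eq0 => /eqP ->; apply/eqP.
by move=> _ [n _ <-]; rewrite invr_ge0 exprn_ge0.
Qed.

Lemma dist_le (a b : fullshift A) n : (0 < n)%N ->
  (forall i : int, (`|i| < n)%N -> a i = b i) -> dist a b <= 2 ^- n :> R.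
Proof.
move=> n0 ab; rewrite /dist ab // eqxx; apply: ge_inf; last by exists n.
by exists 0 => _ [m _ <-]; rewrite invr_ge0 exprn_ge0.
Qed.

Lemma dist_le1 (a b : fullshift A) : dist a b <= 1 :> R.
Proof.
have [ab|ab] := eqVneq (a 0) (b 0); last by rewrite /dist (negbTE ab).
apply: (@le_trans _ _ (2 ^- 1)); last first.
  by rewrite expr1 invf_le1 // ler1n.
apply: dist_le => // i.
by rewrite ltnS leqn0 absz_eq0 => /eqP ->.
Qed.

Lemma dist_lt1 (a b : fullshift A) : dist a b < 1 :> R -> a 0 = b 0.
Proof. by rewrite /dist; case: eqP => // _; rewrite ltxx. Qed.

Lemma sup_dist_ub U g n z : U z ->
  dist (shift n (val z)) (shift n (val (g z))) <= sup_dist U g n.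
Proof.
move=> Uz; apply: ub_le_sup; last by exists z.
by exists 1 => _ [t _ <-]; exact: dist_le1.
Qed.

Definition agree_at_infinity U g : Prop :=
  exists N : nat, forall z, U z -> forall i : int, (N <= `|i|)%N ->
    val (g z) i = val z i.

Lemma sup_dist_cvgP U g :
  (sup_dist U g n%:Z @[n --> \oo] --> (0 : R) /\
   sup_dist U g (- n%:Z) @[n --> \oo] --> (0 : R)) <-> agree_at_infinity U g.
Proof.
split => [[/cvgrPdist_lt/(_ 1 ltr01)[N _ HN]
           /cvgrPdist_lt/(_ 1 ltr01)[M _ HM]]|[N HN]].
  exists (maxn N M) => z Uz i; rewrite geq_max => /andP[Ni Mi].
  suff : dist (shift i (val z)) (shift i (val (g z))) < 1 :> R.
    by move=> /dist_lt1; rewrite /shift /= add0r.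
  apply: le_lt_trans (sup_dist_ub g i Uz) _.
  case: (intP i) Ni Mi => [|n|n] Ni Mi.
  - by have := HN 0%N Ni; rewrite /= sub0r normrN; exact/le_lt_trans/ler_norm.
  - by have := HN n.+1 Ni; rewrite /= sub0r normrN; exact/le_lt_trans/ler_norm.
  - rewrite abszN in Mi.
    by have := HM n.+1 Mi; rewrite /= sub0r normrN; exact/le_lt_trans/ler_norm.
have key (k : nat) (i : int) : (N + k < `|i|)%N ->
    `|0 - sup_dist U g i| <= 2 ^- k.+1.
  move=> ki; rewrite sub0r normrN.
  have [->|/set0P[z Uz]] := eqVneq U set0.
    by rewrite /sup_dist image_set0 sup0 normr0 invr_ge0 exprn_ge0.
  rewrite ger0_norm; last first.
    exact: le_trans (dist_ge0 _ _) (sup_dist_ub g i Uz).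
  apply: ge_sup; first by exists (dist (shift i (val z)) (shift i (val (g z)))), z.
  move=> _ [t Ut <-]; apply: dist_le => // j jk; rewrite /shift HN //.
  lia.
have half_lt (eps : R) : 0 < eps -> exists k : nat, 2 ^- k.+1 < eps.
  move=> eps0; have [k _ /(_ k.+1 (leqnSn _))] :=
    near_infty_natSinv_expn_lt (PosNum eps0).
  by rewrite div1r; exists k.
split; apply/cvgrPdist_lt => eps /half_lt[k keps]; exists (N + k).+1 => // n /= nk.
  by apply: le_lt_trans keps; exact: key.
by apply: le_lt_trans keps; apply: key; rewrite abszN.
Qed.

Lemma homeo_open U V g : open U -> open V -> homeo_between U V g <->
  exists h, [/\ forall x, U x -> V (g x) /\ h (g x) = x,
                forall y, V y -> U (h y) /\ g (h y) = y,
                forall x, U x -> {for x, continuous g} &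
                forall y, V y -> {for y, continuous h}].
Proof.
move=> oU oV; split => [[[gU gI gV] cg [h [hg ch]]]|[h [gP hP cg ch]]].
  exists h; split => [x Ux|_ /gV[x Ux <-]|x Ux|y Vy].
  - by split; [exact: gU | exact: hg].
  - by rewrite hg.
  - by move: cg; rewrite continuous_open_subspace // => /(_ x (mem_set Ux)).
  - by move: ch; rewrite continuous_open_subspace // => /(_ y (mem_set Vy)).
split; first split.
- by move=> x /gP[].
- by move=> x y /set_mem/gP[_ {2}<-] /set_mem/gP[_ {2}<-] ->.
- by move=> y /hP[Uhy ghy]; exists (h y).
- by rewrite continuous_open_subspace // => x /set_mem; exact: cg.
exists h; split; first by move=> x /gP[].
by rewrite continuous_open_subspace // => x /set_mem; exact: ch.
Qed.

Lemma local_conjugacyP U V g : local_conjugacy U V g <->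
  [/\ open U, open V, agree_at_infinity U g &
  exists h, [/\ forall x, U x -> V (g x) /\ h (g x) = x,
                forall y, V y -> U (h y) /\ g (h y) = y,
                forall x, U x -> {for x, continuous g} &
                forall y, V y -> {for y, continuous h}]].
Proof.
split => [[oU oV /(homeo_open _ oU oV) UV s1 s2]|[oU oV gN UV]].
  by split => //; exact/sup_dist_cvgP.
by have [s1 s2] := (sup_dist_cvgP U g).2 gN; split => //; exact/homeo_open.
Qed.

Lemma open_preim U O g : open U -> open O ->
  (forall x, U x -> {for x, continuous g}) -> open (U `&` g @^-1` O).
Proof.
move=> oU oO cg; rewrite openE => x [Ux Ogx]; apply: filterI.
  exact: open_nbhs_nbhs.
by apply: (cg _ Ux); exact: open_nbhs_nbhs.
Qed.

Lemma lc_id U : open U -> local_conjugacy U U id.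
Proof.
move=> oU; apply/local_conjugacyP; split => //; first by exists 0%N.
by exists id; split => // x _; exact: cvg_id.
Qed.

Lemma lc_inv U V g : local_conjugacy U V g ->
  exists h, [/\ local_conjugacy V U h, forall x, U x -> h (g x) = x &
                forall y, V y -> U (h y) /\ g (h y) = y].
Proof.
move=> /local_conjugacyP[oU oV [N gN] [h [gP hP cg ch]]]; exists h; split => //.
  apply/local_conjugacyP; split => //; last by exists g; split.
  by exists N => y /hP[Uhy ghy] i Ni; rewrite -(gN _ Uhy i Ni) ghy.
by move=> x /gP[].
Qed.

Lemma lc_restr U V g W : local_conjugacy U V g -> open W -> W `<=` U ->
  exists V', local_conjugacy W V' g.
Proof.
move=> /local_conjugacyP[oU oV [N gN] [h [gP hP cg ch]]] oW WU.
exists (V `&` h @^-1` W); apply/local_conjugacyP; split => //.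
- exact: open_preim.
- by exists N => z /WU; exact: gN.
exists h; split.
- by move=> x Wx; have [? hgx] := gP _ (WU _ Wx); rewrite /= hgx.
- by move=> y [/hP[]].
- by move=> x /WU; exact: cg.
- by move=> y [] /ch.
Qed.

Lemma lc_comp U V U' V' g g' :
  local_conjugacy U V g -> local_conjugacy U' V' g' ->
  exists W, local_conjugacy (U `&` g @^-1` U') W (g' \o g).
Proof.
move=> /local_conjugacyP[oU oV [N gN] [h [gP hP cg ch]]].
move=> /local_conjugacyP[oU' oV' [N' gN'] [h' [gP' hP' cg' ch']]].
exists (V' `&` h' @^-1` V); apply/local_conjugacyP; split.
- exact: open_preim.
- exact: open_preim.
- exists (maxn N N') => z [Uz U'gz] i; rewrite geq_max => /andP[Ni Ni'].
  by rewrite /= gN' // gN.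
exists (h \o h'); split.
- move=> x [Ux U'gx]; have [Vgx hgx] := gP _ Ux.
  by have [V'ggx h'ggx] := gP' _ U'gx; rewrite /= h'ggx.
- move=> y [V'y Vh'y]; have [Uy ghy] := hP _ Vh'y.
  by have [U'y ghy'] := hP' _ V'y; rewrite /= ghy.
- by move=> x [Ux U'gx]; apply: continuous_comp; [exact: cg | exact: cg'].
- by move=> x [Ux U'gx]; apply: continuous_comp; [exact: ch' | exact: ch].
Qed.

Lemma coord_nbhs x (i : int) : \forall z \near x, val z i = val x i.
Proof.
have c1 : continuous (set_val : X -> fullshift A) by exact: initial_continuous.
have c2 := @proj_continuous _ (fun _ : int => discrete_topology A) i.
have := continuous_comp (c1 x) (c2 (set_val x)).
by move=> /(_ [set val x i]); apply; exact: discrete_set1.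
Qed.

Lemma cylinder_nbhs x N :
  \forall z \near x, forall i : int, (`|i| < N)%N -> val z i = val x i.
Proof.
elim: N => [|N IHN]; first by near=> z; move=> i; rewrite ltn0.
near=> z.
have zN : forall i : int, (`|i| < N)%N -> val z i = val x i.
  by near: z; exact: IHN.
have z1 : val z N%:Z = val x N%:Z by near: z; exact: coord_nbhs.
have z2 : val z (- N%:Z) = val x (- N%:Z) by near: z; exact: coord_nbhs.
move=> i; rewrite ltnS leq_eqVlt => /orP[/eqP iN|/zN //].
by have [->|->] : i = N%:Z \/ i = - N%:Z by lia.
Unshelve. all: by end_near. Qed.

Lemma lc_germ U V U' V' g g' x :
  local_conjugacy U V g -> local_conjugacy U' V' g' -> U x -> U' x ->
  g x = g' x ->
  exists W, [/\ open W, W x, W `<=` U, W `<=` U' & forall z, W z -> g z = g' z].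
Proof.
move=> /local_conjugacyP[oU oV [N gN] [h [gP hP cg ch]]].
move=> /local_conjugacyP[oU' oV' [N' gN'] [h' [gP' hP' cg' ch']]] Ux U'x gx.
have C := cg _ Ux _ (cylinder_nbhs (g x) (maxn N N')).
have C' := cg' _ U'x _ (cylinder_nbhs (g' x) (maxn N N')).
suff : \forall z \near x, [/\ U z, U' z & g z = g' z].
  rewrite /prop_near1 nbhsE => -[W [oW Wx] WP]; exists W; split => // z /WP[] //.
near=> z; have Uz : U z by near: z; exact: open_nbhs_nbhs.
have U'z : U' z by near: z; exact: open_nbhs_nbhs.
split => //; apply: val_inj; apply/funext.
have zg : forall i : int, (`|i| < maxn N N')%N -> val (g z) i = val (g x) i.
  by near: z; exact: C.
have zg' : forall i : int, (`|i| < maxn N N')%N -> val (g' z) i = val (g' x) i.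
  by near: z; exact: C'.
move=> i; have [iN|iN] := leqP (maxn N N') `|i|%N; last by rewrite zg ?zg' ?gx.
by move: iN; rewrite geq_max => /andP[Ni Ni']; rewrite gN // gN'.
Unshelve. all: by end_near. Qed.

Fact lc_refl x : lc_equiv x x.
Proof. by exists setT, setT, id; split => //; apply: lc_id; exact: openT. Qed.

Fact lc_sym x y : lc_equiv x y -> lc_equiv y x.
Proof.
move=> [U [V [g [Ux Vy lc <-]]]]; have [h [lch hg gh]] := lc_inv lc.
exists V, U, h; split => //; last exact: hg.
by have /local_conjugacyP[_ _ _ [? [gP _ _ _]]] := lc; have [] := gP x Ux.
Qed.

Lemma lc_graphP U g x y : lc_graph U g (x, y) <-> U x /\ g x = y.
Proof. by split => [[z Uz [<- <-]]|[Ux <-]]; [|exists x]. Qed.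

Lemma lc_base_equiv U V g x : local_conjugacy U V g -> U x -> lc_equiv x (g x).
Proof.
move=> lc Ux; exists U, V, g; split => //.
by have /local_conjugacyP[_ _ _ [? [gP _ _ _]]] := lc; have [] := gP x Ux.
Qed.

Fact lc_trans x y z : lc_equiv x y -> lc_equiv y z -> lc_equiv x z.
Proof.
move=> [U [V [g [Ux Vy lc <-]]]] [U' [V' [g' [U'x V'z lc' <-]]]].
by have [W] := lc_comp lc lc'; move=> /lc_base_equiv; apply.
Qed.

Fact lc_sub B : lc_base B -> B `<=` [set p | lc_equiv p.1 p.2].
Proof.
by move=> [U [V [g [lc ->]]]] [x y] /lc_graphP[Ux <-]; exact: lc_base_equiv lc Ux.
Qed.

Fact lc_cover p : lc_equiv p.1 p.2 -> exists2 B, lc_base B & B p.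
Proof.
case: p => x y [U [V [g [/= Ux Vy lc gx]]]]; exists (lc_graph U g).
  by exists U, V, g.
exact/lc_graphP.
Qed.

Fact lc_join B C p : lc_base B -> lc_base C -> B p -> C p ->
  exists D, [/\ lc_base D, D p & D `<=` B `&` C].
Proof.
move=> [U [V [g [lc ->]]]] [U' [V' [g' [lc' ->]]]]; case: p => x y.
move=> /lc_graphP[Ux gx] /lc_graphP[U'x g'x].
have [W [oW Wx WU WU' gg']] := lc_germ lc lc' Ux U'x (etrans gx (esym g'x)).
have [V2 lcW] := lc_restr lc oW WU.
exists (lc_graph W g); split; [by exists W, V2, g | exact/lc_graphP|].
move=> [z t] /lc_graphP[Wz gz]; split; apply/lc_graphP; split.
- exact: WU.
- exact: gz.
- exact: WU'.
- by rewrite -gg'.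
Qed.

Fact lc_inverse B x y : lc_base B -> B (x, y) ->
  exists C, [/\ lc_base C, C (y, x) & forall z t, C (z, t) -> B (t, z)].
Proof.
move=> [U [V [g [lc ->]]]] /lc_graphP[Ux <-].
have [h [lch hg gh]] := lc_inv lc.
have /local_conjugacyP[_ _ _ [? [gP _ _ _]]] := lc; have [Vgx _] := gP x Ux.
exists (lc_graph V h); split; [by exists V, U, h | apply/lc_graphP|].
  by split => //; exact: hg.
by move=> z t /lc_graphP[Vz <-]; apply/lc_graphP; exact: gh.
Qed.

Fact lc_mul B x y z : lc_base B -> lc_equiv x y -> lc_equiv y z -> B (x, z) ->
  exists C D, [/\ lc_base C, lc_base D, C (x, y), D (y, z) &
    forall x' y' z', C (x', y') -> D (y', z') -> B (x', z')].
Proof.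
move=> [U0 [V0 [g0 [lc0 ->]]]] [U [V [g [Ux Vy lc <-]]]].
move=> [U' [V' [g' [U'x V'z lc' <-]]]] /lc_graphP[U0x g0x].
have [W' lcc] := lc_comp lc lc'.
have [W [oW Wx WU0 WU gg']] := lc_germ lc0 lcc U0x (conj Ux U'x) g0x.
have [V2 lcW] : exists V2, local_conjugacy W V2 g.
  by apply: lc_restr lc oW _ => w /WU[].
exists (lc_graph W g), (lc_graph U' g'); split.
- by exists W, V2, g.
- by exists U', V', g'.
- exact/lc_graphP.
- exact/lc_graphP.
move=> x' y' z' /lc_graphP[Wx' <-] /lc_graphP[U'x' <-]; apply/lc_graphP.
by split; [exact: WU0 | exact: gg'].
Qed.

Fact lc_inj B x y z : lc_base B -> B (x, y) -> B (x, z) -> y = z.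
Proof.
by move=> [U [V [g [_ ->]]]] /lc_graphP[_ <-] /lc_graphP[_ <-].
Qed.

Fact lc_unit B x y : lc_base B -> B (x, y) ->
  exists C, [/\ lc_base C, C (x, x) &
    forall z t, C (z, t) -> z = t /\ exists u, B (z, u)].
Proof.
move=> [U [V [g [[oU _ _ _ _] ->]]]] /lc_graphP[Ux _].
exists (lc_graph U id); split; [|exact/lc_graphP|].
  by exists U, U, id; split => //; exact: lc_id.
move=> z t /lc_graphP[Uz <-]; split => //.
by exists (g z); exact/lc_graphP.
Qed.

Definition lc_eqrel : etaleEqrel X :=
  EtaleEqrel lc_refl lc_sym lc_trans lc_sub lc_cover lc_join lc_inverse
    lc_mul lc_inj lc_unit.

Definition lc_groupoid : etaleGroupoid := eqrel_groupoid lc_eqrel.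

End LocalConjugacy.

Section ContextDiagram.
Variables (A : finType) (X : set (fullshift A)).

Definition language : set (seq A) :=
  [set w | exists2 x, X x & exists i : int,
             w = mkseq (fun k => x (i + k%:Z)) (size w)].

Definition context (w : seq A) : set (seq A * seq A) :=
  [set ab | [/\ language ab.1, language ab.2 & language (ab.1 ++ w ++ ab.2)]].

Definition language_of (m : nat) : {set m.-tuple A} :=
  [set w : m.-tuple A | `[< language w >]].

Definition context_equiv (m : nat) : rel (m.-tuple A) :=
  fun w v => `[< context w = context v >].

(* L_m(X)/~, as the finite type of equivalence classes *)
Definition context_class (m : nat) : finType :=
  {C : {set m.-tuple A} |
    C \in equivalence_partition (@context_equiv m) (language_of m)}.

Lemma mem_language_of m (w : m.-tuple A) :
  (w \in language_of m) <-> language w.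
Proof. by rewrite inE; split => /asboolP. Qed.

Lemma class_of_subproof m (w : m.-tuple A) : language w ->
  [set v in language_of m | context_equiv w v]
    \in equivalence_partition (@context_equiv m) (language_of m).
Proof. by move=> /mem_language_of Lw; apply: imset_f. Qed.

Definition class_of m (w : m.-tuple A) (Lw : language w) : context_class m :=
  exist (fun C => C \in equivalence_partition (@context_equiv m) (language_of m))
    _ (class_of_subproof Lw).

(* the word a w b *)
Definition extend m (ab : A * A) (w : m.-tuple A) : m.+2.-tuple A :=
  [tuple of ab.1 :: rcons w ab.2].

Definition letter_context m (w : m.-tuple A) (ab : A * A) : Prop :=
  context w ([:: ab.1], [:: ab.2]).

(* Membership of (a, b) in E(w) and the class of a w b do not depend on the
   representative w of the class; see [letter_context_class] and
   [lc_termS_class]. *)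
Definition class_edge (m : nat) : finType :=
  {e : context_class m * (A * A) |
    [exists w in val e.1, `[< letter_context w e.2 >]]}.

Lemma extend_language m (w : m.-tuple A) ab :
  letter_context w ab -> language (extend ab w).
Proof. by move=> [_ _]; rewrite /= cats1. Qed.

Lemma class_edge_repr m (e : class_edge m) :
  exists w, (w \in val (val e).1) && `[< letter_context w (val e).2 >].
Proof. exact/existsP/(valP e). Qed.

Lemma class_edge_language m (e : class_edge m) :
  language (extend (val e).2 (xchoose (class_edge_repr e))).
Proof.
by have /andP[_ /asboolP] := xchooseP (class_edge_repr e);
  exact: extend_language.
Qed.

Definition letter : finType := {a : A | `[< language [:: a] >]}.

Lemma letter_language (a : letter) : language [tuple val a].
Proof. exact/asboolP/(valP a). Qed.

(* Level 0 is the index -1, and level n.+1 the index n. *)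
Definition lc_vert (n : nat) : finType :=
  if n is n'.+1 then context_class n'.*2.+1 else unit.

Definition lc_edge (n : nat) : finType :=
  if n is n'.+1 then class_edge n'.*2.+1 else letter.

Definition lc_init (n : nat) : lc_edge n -> lc_vert n :=
  match n with
  | 0 => fun _ => tt
  | n'.+1 => fun e => (val e).1
  end.

Definition lc_term (n : nat) : lc_edge n -> lc_vert n.+1 :=
  match n return lc_edge n -> lc_vert n.+1 with
  | 0 => fun a => class_of (letter_language a)
  | n'.+1 => fun e => class_of (class_edge_language e)
  end.

Definition lc_diagram : bratteli := Bratteli lc_init lc_term.

Lemma context_class_mem m (C : context_class m) (w : m.-tuple A) :
  w \in val C <-> exists Lw : language w, C = class_of Lw.
Proof.
split=> [|[Lw ->]]; last first.
  by rewrite !inE; apply/andP; split; apply/asboolP.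
move=> wC; have /imsetP[v _ CE] := valP C; move: wC.
rewrite CE !inE => /andP[/asboolP Lw /asboolP vw]; exists Lw.
apply: val_inj; rewrite /= CE; apply/setP => u.
by rewrite !inE /context_equiv vw.
Qed.

Lemma context_class_eq m (C : context_class m) (w v : m.-tuple A) :
  w \in val C -> v \in val C -> context w = context v.
Proof.
move=> wC; have [Lw ->] := (context_class_mem C w).1 wC.
by rewrite !inE => /andP[_ /asboolP].
Qed.

Lemma letter_context_class m (C : context_class m) (w v : m.-tuple A) ab :
  w \in val C -> v \in val C -> letter_context w ab <-> letter_context v ab.
Proof. by move=> wC vC; rewrite /letter_context (context_class_eq wC vC). Qed.

Lemma languageP w : language w <-> exists2 x, X x & exists i : int,
  forall a0 k, (k < size w)%N -> nth a0 w k = x (i + k%:Z).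
Proof.
split => [[x Xx [i wE]]|[x Xx [i wE]]]; exists x => //; exists i.
  by move=> a0 k kw; rewrite wE nth_mkseq.
case: w wE => [//|a w] wE.
apply: (@eq_from_nth _ a); rewrite ?size_mkseq // => k kw.
by rewrite nth_mkseq // (wE a).
Qed.

Lemma language_cat u v : language (u ++ v) -> language u /\ language v.
Proof.
move=> /languageP[x Xx [i uvE]]; split; apply/languageP; exists x => //.
  exists i => a0 k ku; rewrite -(uvE a0) ?nth_cat ?ku //.
  by rewrite size_cat ltn_addr.
exists (i + (size u)%:Z) => a0 k kv.
rewrite -addrA -PoszD -(uvE a0) ?size_cat ?ltn_add2l //.
by rewrite nth_cat ltnNge leq_addr /= addKn.
Qed.

Lemma context_extend m (w : m.-tuple A) ab x y :
  context (extend ab w) (x, y) <-> context w (rcons x ab.1, ab.2 :: y).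
Proof.
have E : x ++ extend ab w ++ y = rcons x ab.1 ++ w ++ ab.2 :: y.
  by rewrite /= cat_rcons -cats1 -catA.
rewrite /context /= in E *; split => -[_ _ L]; split => //.
- by move: L; rewrite E => /language_cat[].
- by move: L; rewrite E => /language_cat[_ /language_cat[]].
- by rewrite -E.
- by move: L; rewrite -E => /language_cat[].
- by move: L; rewrite -E => /language_cat[_ /(@language_cat (_ :: _))[]].
- by rewrite E.
Qed.

Lemma lc_termS_class n (e : lc_edge n.+1) w (wE : w \in val (val e).1) :
  exists awb : language (extend (val e).2 w), lc_term e = class_of awb.
Proof.
have /andP[rE /asboolP re] := xchooseP (class_edge_repr e).
have we : letter_context w (val e).2 by apply/(letter_context_class _ wE rE).
have rw : context (xchoose (class_edge_repr e)) = context w.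
  exact: context_class_eq rE wE.
exists (extend_language we); apply: val_inj; apply/setP => u.
suff rwE : context (extend (val e).2 (xchoose (class_edge_repr e))) =
    context (extend (val e).2 w) by rewrite !inE /context_equiv rwE.
apply/seteqP; split => -[x y] /context_extend H; apply/context_extend;
  by rewrite ?rw // -?rw.
Qed.

End ContextDiagram.

(* Main.v *)
(* A point [x] of [X] is encoded by the path whose labels are its coordinates,
   read from the centre outwards, and whose vertices are the context classes of
   the central words [x_[-n,n]]; closedness of [X] makes this a bijection onto
   the path space.  Two paths agree beyond level [M] exactly when the points
   agree outside [-M,M] and the words [x_[-n,n]], [y_[-n,n]] have the same
   context for all [n >= M].  In that case, replacing the central word of [x]
   by that of [y] is a local conjugacy between two cylinders.  Conversely, by
   continuity, a local conjugacy mapping [x] to [y] is, on a small enough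
   cylinder around [x], such a replacement; hence the context of [x_[-n,n]] is
   contained in that of [y_[-n,n]] for all large [n], and the inverse gives the
   other inclusion.  So the two bases correspond. *)

Require Import Defs.
From mathcomp Require Import all_boot all_order all_algebra.
From mathcomp Require Import all_classical all_reals.
From mathcomp Require Import topology.
From mathcomp Require Import zify.

Set Implicit Arguments.
Unset Strict Implicit.
Unset Printing Implicit Defensive.

Import Order.TTheory GRing.Theory Num.Theory.

Local Open Scope classical_set_scope.
Local Open Scope ring_scope.

(** * Groupoid isomorphisms induced by a bijection of unit spaces *)

Section ReflectsBase.
Variables (S S' : choiceType) (F : etaleEqrel S) (F' : etaleEqrel S').
Variable phi : S -> S'.

(* The preimage of a basic set under [phi * phi] is covered by basic sets: this
   gives both that equivalence descends along [phi] and that the induced map on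
   arrows is continuous. *)
Definition reflects_base : Prop :=
  forall B x y, er_base F' B -> B (phi x, phi y) ->
  exists C, [/\ er_base F C, C (x, y) &
    forall z t, C (z, t) -> B (phi z, phi t)].

Lemma reflects_base_rel x y :
  reflects_base -> er_rel F' (phi x) (phi y) -> er_rel F x y.
Proof.
move=> rphi xy; have [B DB Bxy] := er_cover (p := (phi x, phi y)) xy.
by have [C [DC Cxy _]] := rphi _ _ _ DB Bxy; exact: er_sub DC _ Cxy.
Qed.

Lemma pair_map_continuous (f : er_arrow F -> er_arrow F') :
  reflects_base ->
  (forall g, val (f g) = (phi (val g).1, phi (val g).2)) -> continuous f.
Proof.
move=> rphi fE g O /er_nbhsP[B [DB Bg BO]].
move: Bg; rewrite /er_open_base /= fE => /(rphi _ _ _ DB)[C [DC Cg CB]].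
apply/er_nbhsP; exists C; split => //.
  by rewrite /er_open_base /= [val g]surjective_pairing.
move=> h; rewrite /er_open_base /= [val h]surjective_pairing => /CB.
by rewrite -fE => ?; apply: BO.
Qed.

End ReflectsBase.

(** Each reflection hypothesis is used twice: for [phi] it yields continuity of the map on arrows
    and, as [psi] inverts [phi], that [psi] preserves equivalence; for [psi], symmetrically. *)
Lemma eqrel_groupoid_iso (T T' : choiceType) (E : etaleEqrel T)
    (E' : etaleEqrel T') (phi : T -> T') (psi : T' -> T) :
  cancel phi psi -> cancel psi phi ->
  reflects_base E E' phi -> reflects_base E' E psi ->
  groupoid_isomorphic (eqrel_groupoid E) (eqrel_groupoid E').
Proof.
move=> phiK psiK rphi rpsi.
have relf (g : er_arrow E) : er_rel E' (phi (val g).1) (phi (val g).2).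
  by apply: (reflects_base_rel rpsi); rewrite !phiK; exact: er_arrowP.
have relf' (g : er_arrow E') : er_rel E (psi (val g).1) (psi (val g).2).
  by apply: (reflects_base_rel rphi); rewrite !psiK; exact: er_arrowP.
pose f g := er_mk (relf g); pose f' g := er_mk (relf' g).
have fcomp (g h : er_arrow E) :
    er_composable g h <-> er_composable (f g) (f h).
  by rewrite /er_composable /=; split => [->//|/(can_inj phiK)].
exists f, f'; split.
- by move=> g; apply: val_inj; rewrite /= !phiK -surjective_pairing.
- by move=> g; apply: val_inj; rewrite /= !psiK -surjective_pairing.
- exact: pair_map_continuous rphi _.
- exact: pair_map_continuous rpsi _.
split=> // g h gh; apply: val_inj; rewrite /= er_mmulE //.
by rewrite er_mmulE //; exact/fcomp.
Qed.

(** * Cylinders, central words and iterated shifts in the full shift *)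

Section Windows.
Variable A : finType.
Implicit Types (x y z : fullshift A).

Definition agree (N : nat) x y := forall i : int, (`|i| < N)%N -> x i = y i.

Lemma nbhs_cylinder x (O : set (fullshift A)) : nbhs x O ->
  exists N, forall z, agree N z x -> O z.
Proof.
pose F : set_system (fullshift A) :=
  filter_from [set: nat] (fun N => [set z | agree N z x]).
have FF : Filter F.
  apply: filter_from_filter; first by exists 0%N.
  move=> M N _ _; exists (maxn M N) => // z zx.
  by split => i iN; apply: zx; rewrite leq_max iN ?orbT.
(* The topology is the supremum of those pulled back along the coordinates, so convergence is
   checked one coordinate [i] at a time; the cylinder of radius [|i|+1] fixes it. *)
have : F --> x.
  apply/cvg_sup => i O' [_ [[V _ <-] Vx VO']].
  exists `|i|.+1 => // z zx; apply: VO'; rewrite /= zx //.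
by move=> /[apply] -[N _ NO]; exists N.
Qed.

Definition window (n : nat) x : n.*2.+1.-tuple A :=
  [tuple x (i%:Z - n%:Z) | i < n.*2.+1].

Lemma nth_window a n x k : (k < n.*2.+1)%N ->
  nth a (window n x) k = x (k%:Z - n%:Z).
Proof.
by move=> kn; rewrite -[k]/(nat_of_ord (Ordinal kn)) -tnth_nth tnth_mktuple.
Qed.

Lemma eq_window n x y : agree n.+1 x y -> window n x = window n y.
Proof.
move=> xy; apply: eq_from_tnth => i; rewrite !tnth_mktuple xy //.
by have := ltn_ord i; lia.
Qed.

Lemma window0 x : window 0 x = [tuple x 0].
Proof.
apply: eq_from_tnth => i.
by rewrite tnth_mktuple (ord1 i) (tnth_nth (x 0)) /= subr0.
Qed.

Lemma windowS n x :
  window n.+1 x = extend (x (- n.+1%:Z), x n.+1%:Z) (window n x).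
Proof.
apply/val_inj/(@eq_from_nth _ (x 0)); first by rewrite !size_tuple.
move=> k; rewrite size_tuple => kn; rewrite nth_window //.
case: k kn => [|k] kn; first by rewrite /= sub0r.
rewrite -[RHS]/(nth (x 0) (rcons (window n x) (x n.+1%:Z)) k).
rewrite nth_rcons size_tuple; case: ltngtP => [kn'|kn'|->].
- by rewrite nth_window //; congr (x _); lia.
- by lia.
- by congr (x _); lia.
Qed.

Lemma shift_shift m n x : shift m (shift n x) = shift (m + n) x.
Proof. by apply/funext => i; rewrite /shift addrA. Qed.

Lemma shift0 x : shift 0 x = x.
Proof. by apply/funext => i; rewrite /shift addr0. Qed.

Lemma shift_space_shift (X : set (fullshift A)) n x :
  shift_space X -> X x -> X (shift n x).
Proof.
move=> [_ sX]; case: (intP n) => [|m|m].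
- by rewrite shift0.
- elim: m x => [|m IHm] x Xx; first by rewrite -sX; exists x.
  rewrite -[m.+2]addn1 PoszD -shift_shift; apply: IHm.
  by rewrite -sX; exists x.
(* Negative shifts use the other half of the equality: the shift maps [X] onto [X]. *)
have sX1 y : X y -> X (shift (- 1) y).
  by rewrite -{1}sX => -[z Xz <-]; rewrite shift_shift addNr shift0.
elim: m x => [|m IHm] x Xx; first exact: sX1.
by rewrite -[m.+2]addn1 PoszD opprD -shift_shift; apply/IHm/sX1.
Qed.

End Windows.

(** * The bijection between points and infinite paths *)

Lemma path_term (B : bratteli) (e : path_space B) n :
  term (val e n) = init (val e n.+1).
Proof. by have /set_mem := valP e; apply. Qed.

Section Coding.
Variables (A : finType) (X : set (fullshift A)).
Hypothesis hX : shift_space X.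
Implicit Types (x y z : X).

Lemma language_window n (x : fullshift A) : X x -> language X (window n x).
Proof.
move=> Xx; apply/languageP; exists x => //; exists (- n%:Z) => a k.
by rewrite size_tuple => kn; rewrite nth_window // addrC.
Qed.

(** An occurrence of [a w b] in a point of [X] can be shifted so that [w] sits at the origin; the
    replacement given by the hypothesis then turns it into an occurrence of [a v b]. *)
Lemma context_window_sub n (x y : fullshift A) :
  (forall z : fullshift A, X z -> agree n.+1 z x ->
    exists t, [/\ X t, agree n.+1 t y &
      forall i : int, (n < `|i|)%N -> t i = z i]) ->
  context X (window n x) `<=` context X (window n y).
Proof.
move=> xy [a b] [La Lb /languageP[z0 Xz0 [i]]].
rewrite -[_ ++ _]/(a ++ window n x ++ b) => z0E; split=> //.
rewrite -[_ ++ _]/(a ++ window n y ++ b).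
(* The position in [z0] of the middle letter of the central word: [a] starts at [i], and the middle
   lies [n] letters into the window. *)
pose s : int := i + (size a)%:Z + n%:Z.
have zx : agree n.+1 (shift s z0) x.
  move=> j jn; pose k := `|(j + n%:Z)%R|%N.
  have kE : k%:Z = j + n%:Z by lia.
  have kn : (k < n.*2.+1)%N by lia.
  have -> : x j = x (k%:Z - n%:Z) by congr (x _); lia.
  rewrite -(nth_window (z0 0)) //.
  have := z0E (z0 0) (size a + k)%N.
  rewrite nth_cat ifN -?leqNgt ?leq_addr // addKn nth_cat !size_tuple kn => ->.
    by rewrite /shift /s; congr (z0 _); lia.
  rewrite !size_cat size_tuple; lia.
have [t [Xt ty tz]] := xy _ (shift_space_shift s hX Xz0) zx.
apply/languageP; exists t => //; exists (- (size a)%:Z - n%:Z) => c k.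
rewrite !size_cat size_tuple => kn.
have := z0E c k; rewrite !size_cat size_tuple => /(_ kn).
rewrite !nth_cat !size_tuple; case: ltnP => ka.
  by move=> ->; rewrite tz /shift /s; [congr (z0 _)|]; lia.
case: ltnP => kan; last first.
  by move=> ->; rewrite tz /shift /s; [congr (z0 _)|]; lia.
by move=> _; rewrite nth_window // ty; [congr (y _)|]; lia.
Qed.

Lemma class_of_eq m (w v : m.-tuple A) (Lw : language X w) (Lv : language X v) :
  class_of Lw = class_of Lv <-> context X w = context X v.
Proof.
split=> [wv|wv]; last first.
  by apply/val_inj/setP => u; rewrite !inE /context_equiv wv.
apply: (context_class_eq (C := class_of Lv)).
  by apply/context_class_mem; exists Lw.
by apply/context_class_mem; exists Lv.
Qed.

Lemma mem_class_of m (w : m.-tuple A) (Lw : language X w) :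
  w \in val (class_of Lw).
Proof. by apply/context_class_mem; exists Lw. Qed.

Lemma val_mem x : X (val x). Proof. exact/set_mem/(valP x). Qed.

Lemma encode_letter_subproof x : `[< language X [:: val x 0] >].
Proof.
apply/asboolP/languageP; exists (val x); first exact: val_mem.
by exists 0 => a [|//] _; rewrite addr0.
Qed.

Definition encode_letter x : letter X :=
  exist _ (val x 0) (encode_letter_subproof x).

Definition encode_label n x : A * A := (val x (- n.+1%:Z), val x n.+1%:Z).

Definition window_class n x : context_class X n.*2.+1 :=
  class_of (language_window n (val_mem x)).

Lemma letter_context_window n x :
  letter_context X (window n (val x)) (encode_label n x).
Proof.
have := language_window n.+1 (val_mem x).
rewrite windowS -[tval _]/([:: (encode_label n x).1] ++ rcons _ _) -cats1 => L.
have [La /language_cat[_ Lb]] := language_cat L.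
by split.
Qed.

Lemma encode_edge_subproof n x :
  [exists w in val (window_class n x),
     `[< letter_context X w (encode_label n x) >]].
Proof.
apply/existsP; exists (window n (val x)); rewrite mem_class_of.
exact/asboolP/letter_context_window.
Qed.

Definition encode_edge n x : class_edge X n.*2.+1 :=
  exist _ (window_class n x, encode_label n x) (encode_edge_subproof n x).

Definition encode_fun x (n : nat) : edge (lc_diagram X) n :=
  match n return lc_edge X n with
  | 0 => encode_letter x
  | m.+1 => encode_edge m x
  end.

Lemma term_encode_fun n x : term (encode_fun x n) = window_class n x.
Proof.
case: n => [|n].
  by apply/class_of_eq; rewrite window0.
have [awb awbE] := @lc_termS_class _ _ n (encode_fun x n.+1) _ (mem_class_of _).
by rewrite [LHS]awbE; apply/class_of_eq; rewrite windowS.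
Qed.

Lemma encode_subproof x : paths (encode_fun x).
Proof. by move=> n; rewrite term_encode_fun. Qed.

Definition encode x : path_space (lc_diagram X) :=
  SigSub (mem_set (encode_subproof x)).

Implicit Types e : path_space (lc_diagram X).

(** Only labels are read. Since [Negz n] is [-(n+1)], both coordinates [n+1] and [-(n+1)] come from
    the edge at level [n+1]. *)
Definition decode_fun e : fullshift A := fun i : int =>
  match i with
  | Posz 0 => val (val e 0 : letter X)
  | Posz n.+1 => (val (val e n.+1 : class_edge X n.*2.+1)).2.2
  | Negz n => (val (val e n.+1 : class_edge X n.*2.+1)).2.1
  end.

(** By induction along the path: [lc_termS_class] lets the decoded window serve as representative of
    each vertex. Hence the labels determine the vertices. *)
Lemma window_decode e n :
  window n (decode_fun e) \in val (term (val e n) : context_class X n.*2.+1).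
Proof.
elim: n => [|n IHn].
  apply/context_class_mem.
  by rewrite window0; exists (letter_language (val e 0%N)).
rewrite path_term in IHn.
have [awb awbE] := @lc_termS_class _ _ n (val e n.+1) _ IHn.
apply/context_class_mem; rewrite [term _]awbE.
have wE : window n.+1 (decode_fun e) =
  extend (val (val e n.+1 : class_edge X n.*2.+1)).2 (window n (decode_fun e)).
  by rewrite windowS -NegzE [(val _).2]surjective_pairing.
have Lw : language X (window n.+1 (decode_fun e)) by rewrite wE.
by exists Lw; apply/class_of_eq; rewrite wE.
Qed.

Lemma decode_fun_encode x : decode_fun (encode x) = val x.
Proof. by apply/funext => -[[|n]|n]. Qed.

Lemma decode_subproof e : X (decode_fun e).
Proof.
(* By closedness it suffices to approximate on each cylinder; the decoded window of radius [N] lies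
   in the language, so a shifted point of [X] shows it at the origin. *)
have [cX _] := hX; apply: cX => O /nbhs_cylinder[N NO].
have [Lw _] := (context_class_mem _ _).1 (window_decode e N).
have /languageP[x Xx [i xE]] := Lw.
exists (shift (i + N%:Z) x); split; first exact: shift_space_shift.
apply: NO => j jN.
have := xE (x 0) `|(j + N%:Z)%R|%N; rewrite size_tuple => kN.
have := kN _; rewrite nth_window; last by lia.
have -> : `|(j + N%:Z)%R|%N%:Z - N%:Z = j by lia.
by move=> ->; [rewrite /shift; congr (x _)|]; lia.
Qed.

Definition decode e : X := SigSub (mem_set (decode_subproof e)).

Lemma encodeK : cancel encode decode.
Proof. by move=> x; apply: val_inj; exact: decode_fun_encode. Qed.

Lemma decodeK : cancel decode encode.
Proof.
move=> e; apply: path_eq => -[|n]; first exact: val_inj.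
apply: val_inj => /=; rewrite [RHS]surjective_pairing; congr (_, _); last first.
  exact: esym (surjective_pairing _).
have := window_decode e n; rewrite path_term /= => /context_class_mem[Lw ->].
exact/class_of_eq.
Qed.

Lemma encode_eqS n x y : val (encode x) n.+1 = val (encode y) n.+1 <->
  context X (window n (val x)) = context X (window n (val y)) /\
  (val x (- n.+1%:Z) = val y (- n.+1%:Z) /\ val x n.+1%:Z = val y n.+1%:Z).
Proof.
split=> [xy|[c [l r]]].
  have : encode_edge n x = encode_edge n y by [].
  move=> /(congr1 val) xy'; split; last first.
    by have [] := congr1 snd xy'.
  by have /class_of_eq := congr1 fst xy'.
apply: val_inj; congr (_, _); first exact/class_of_eq.
by rewrite /encode_label l r.
Qed.

Lemma decode_fun_eq e f (i : int) :
  val e `|i|%N = val f `|i|%N -> decode_fun e i = decode_fun f i.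
Proof. by case: i => [[|n]|n] /= ->. Qed.

Lemma encode_eq_coord x y (i : int) :
  val (encode x) `|i|%N = val (encode y) `|i|%N -> val x i = val y i.
Proof. by move=> /decode_fun_eq; rewrite !decode_fun_encode. Qed.

(** Contexts drop out here, unlike in [encode_eqS]: agreement from the centre outwards makes the
    windows themselves equal. *)
Lemma encode_eq_agree x y n :
  (forall k, (k <= n)%N -> val (encode x) k = val (encode y) k) <->
  agree n.+1 (val x) (val y).
Proof.
split=> [xy i iN|xy [|k] kn]; first exact/encode_eq_coord/xy.
  by apply: val_inj; rewrite /= xy.
apply/encode_eqS; rewrite !xy; [|lia|lia]; split=> //.
rewrite (@eq_window _ _ (val x) (val y)) // => i ik.
by apply: xy; lia.
Qed.

End Coding.

(** * Replacing central words, and its relation to local conjugacies *)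

Lemma tail_graph_total (B : bratteli) (e e' f : path_space B) M :
  (forall n, (M < n)%N -> val e n = val e' n) ->
  (forall n, (n <= M)%N -> val f n = val e n) ->
  exists u, tail_graph e e' M (f, u).
Proof.
move=> ee' fe.
have uP : paths (fun n => if (n <= M)%N then val e' n else val f n).
  move=> n /=; have [nM|nM|->] := ltngtP n M; rewrite ?path_term //.
  (* At the seam [n = M] the vertices match because [e] and [e'] share the edge at level [M+1]. *)
  by rewrite -ee' // -path_term -fe // path_term.
exists (SigSub (mem_set uP)); split => //= n; first by move=> ->.
by rewrite ltnNge => /negbTE ->.
Qed.

Section Splicing.
Variables (A : finType) (X : set (fullshift A)).
Implicit Types (x y z t : X).

(** A relation rather than a function, because the spliced sequence need not belong to [X]. *)
Definition splice M y z t := agree M.+1 (val t) (val y) /\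
  forall i : int, (M < `|i|)%N -> val t i = val z i.

Lemma splice_unique M y z t t' : splice M y z t -> splice M y z t' -> t = t'.
Proof.
move=> [ty tz] [t'y t'z]; apply/val_inj/funext => i.
by have [iM|iM] := ltnP M `|i|%N; [rewrite tz // t'z | rewrite ty // t'y].
Qed.

Lemma tail_graph_splice M x y z t :
  tail_graph (encode x) (encode y) M (encode z, encode t) ->
  agree M.+1 (val z) (val x) /\ splice M y z t.
Proof.
move=> [/= zx ty tz]; split; first exact/encode_eq_agree.
by split; [exact/encode_eq_agree | move=> i /tz/encode_eq_coord].
Qed.

Lemma nbhs_subcylinder x (O : set X) : nbhs x O ->
  exists N, forall z, agree N (val z) (val x) -> O z.
Proof.
move=> [_ [[V oV <-] Vx VO]].
have [N NV] := nbhs_cylinder (open_nbhs_nbhs (conj oV Vx)).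
by exists N => z /NV; exact: VO.
Qed.

Lemma open_cylinder x N : open [set z : X | agree N (val z) (val x)].
Proof.
rewrite openE => z zx; apply: filterS (cylinder_nbhs z N) => t tz i iN.
by rewrite tz // zx.
Qed.

(** Each coordinate of [g z] is either constant on [U] or equal to the same coordinate of [z]. *)
Lemma splice_continuous M y (U : set X) (g : X -> X) : open U ->
  (forall z, U z -> splice M y z (g z)) ->
  forall z, U z -> {for z, continuous g}.
Proof.
move=> oU gP z Uz O /nbhs_subcylinder[N NO].
have Uz' : nbhs z U by exact: open_nbhs_nbhs.
apply: filterS (filterI Uz' (cylinder_nbhs z N)) => t [Ut tz].
apply: NO => i iN.
have [gzy gz] := gP _ Uz; have [gty gt] := gP _ Ut.
by have [iM|iM] := ltnP M `|i|%N; [rewrite gt // gz // tz | rewrite gty // gzy].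
Qed.

Lemma splice_local_conjugacy (R : realType) M x y (g h : X -> X) :
  (forall z, agree M.+1 (val z) (val x) -> splice M y z (g z)) ->
  (forall z, agree M.+1 (val z) (val y) -> splice M x z (h z)) ->
  local_conjugacy R [set z | agree M.+1 (val z) (val x)]
    [set z | agree M.+1 (val z) (val y)] g.
Proof.
move=> gP hP.
(* Splicing back restores [z] by uniqueness; stated generally so as to apply to both composites. *)
have cancel_splice x' y' (g' h' : X -> X) z :
    (forall z, agree M.+1 (val z) (val x') -> splice M y' z (g' z)) ->
    (forall z, agree M.+1 (val z) (val y') -> splice M x' z (h' z)) ->
    agree M.+1 (val z) (val x') -> h' (g' z) = z.
  move=> g'P h'P zx; have [gzy gz] := g'P _ zx.
  apply: (splice_unique (h'P _ gzy)); split=> // i /gz; exact: esym.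
apply/local_conjugacyP; split; [exact: open_cylinder|exact: open_cylinder| |].
  by exists M.+1 => z /gP[_ gz] i; exact: gz.
exists h; split.
- by move=> z zx; split; [have [] := gP _ zx | exact: cancel_splice gP hP zx].
- by move=> z zy; split; [have [] := hP _ zy | exact: cancel_splice hP gP zy].
- exact: splice_continuous (open_cylinder _ _) gP.
- exact: splice_continuous (open_cylinder _ _) hP.
Qed.

Hypothesis hX : shift_space X.

Lemma exists_tail_graph_map M x y :
  (forall n, (M < n)%N -> val (encode x) n = val (encode y) n) ->
  exists g : X -> X, forall z, agree M.+1 (val z) (val x) ->
    tail_graph (encode x) (encode y) M (encode z, encode (g z)).
Proof.
move=> xy.
have /choice[g gP] : forall z, exists t, agree M.+1 (val z) (val x) ->
    tail_graph (encode x) (encode y) M (encode z, encode t); last by exists g.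
move=> z.
have [zx|nzx] := pselect (agree M.+1 (val z) (val x)); last by exists z.
have /encode_eq_agree zx' := zx.
have [u zu] := tail_graph_total xy zx'.
by exists (decode hX u); rewrite decodeK.
Qed.

Lemma encode_reflects_base (R : realType) :
  reflects_base (lc_eqrel R X) (tail_eqrel (lc_diagram X)) (@encode A X).
Proof.
move=> _ x y [e [e' [M [ee' ->]]]] [/= xe ye xy].
have [g gP] : exists g : X -> X, forall z, agree M.+1 (val z) (val x) ->
    tail_graph (encode x) (encode y) M (encode z, encode (g z)).
  by apply: exists_tail_graph_map => n /xy.
have [h hP] : exists h : X -> X, forall z, agree M.+1 (val z) (val y) ->
    tail_graph (encode y) (encode x) M (encode z, encode (h z)).
  exact: exists_tail_graph_map.
have gS z (zx : agree M.+1 (val z) (val x)) := (tail_graph_splice (gP z zx)).2.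
have hS z (zy : agree M.+1 (val z) (val y)) := (tail_graph_splice (hP z zy)).2.
(* Since [(x, y)] lies in the basic set of [e], [e'] and [M], its cylinders up to level [M] are
   those of [x] and [y]. *)
exists (lc_graph [set z | agree M.+1 (val z) (val x)] g); split.
- by do 3 eexists; split; first exact: splice_local_conjugacy gS hS.
- apply/lc_graphP; split=> //; have gx : agree M.+1 (val x) (val x) by [].
  apply: splice_unique (gS x gx) _; split=> // i.
  by move=> /xy/encode_eq_coord.
move=> z t /lc_graphP[/gP[/= zx gy gz] <-].
by split=> //= n nM; rewrite ?zx ?xe ?gy ?ye.
Qed.

(** Far out [g] changes no coordinate; near the centre continuity at [x] makes [g z] agree with
    [g x]. A large enough cylinder radius covers both ranges. *)
Lemma local_conjugacy_splice (R : realType) U V g x :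
  local_conjugacy R U V g -> U x -> exists N, forall M, (N <= M)%N ->
  forall z, agree M.+1 (val z) (val x) -> U z /\ splice M (g x) z (g z).
Proof.
move=> /local_conjugacyP[oU _ [N gN] [h [_ _ cg _]]] Ux.
have nU : nbhs x U by exact: open_nbhs_nbhs.
have nV := cg _ Ux _ (cylinder_nbhs (g x) N).
have [K KP] := nbhs_subcylinder (filterI nU nV).
exists (maxn N K) => M; rewrite geq_max => /andP[NM KM] z zx.
have [Uz gzx] : U z /\ agree N (val (g z)) (val (g x)).
  by apply: KP => i iK; apply: zx; lia.
split=> //; split=> [i iM|i iM]; last by apply: gN => //; lia.
have [iN|iN] := ltnP `|i|%N N; first exact: gzx.
by rewrite gN // zx // gN.
Qed.

Lemma context_splice_sub M x y (g : X -> X) :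
  (forall z, agree M.+1 (val z) (val x) -> splice M y z (g z)) ->
  context X (window M (val x)) `<=` context X (window M (val y)).
Proof.
move=> gP; apply: context_window_sub => // z Xz zx.
pose z' : X := SigSub (mem_set Xz); have [gy gz] := gP z' zx.
by exists (val (g z')); split=> //; exact: val_mem.
Qed.

Lemma decode_reflects_base (R : realType) :
  reflects_base (tail_eqrel (lc_diagram X)) (lc_eqrel R X) (decode hX).
Proof.
move=> _ e e' [U [V [g [lc ->]]]].
rewrite -[e](decodeK hX) -[e'](decodeK hX) !encodeK.
move: (decode hX e) (decode hX e') => x _ /lc_graphP[Ux <-].
have [h [lch hg gh]] := lc_inv lc.
have Vgx : V (g x).
  by have /local_conjugacyP[_ _ _ [? [gP _ _ _]]] := lc; have [] := gP x Ux.
have [N gN] := local_conjugacy_splice lc Ux.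
have [K hK] := local_conjugacy_splice lch Vgx.
pose M := maxn N K.
have gM n (Mn : (M <= n)%N) := gN n (leq_trans (leq_maxl N K) Mn).
have hM n (Mn : (M <= n)%N) := hK n (leq_trans (leq_maxr N K) Mn).
have encodeM n : (M < n)%N -> val (encode x) n = val (encode (g x)) n.
  case: n => [//|n Mn]; apply/encode_eqS; split; last first.
    have [_ [_ gxE]] := gM _ (leqnn M) x (fun _ _ => erefl).
    by rewrite !gxE //; lia.
  (* One inclusion of contexts comes from [g], the other from its inverse [h], which sends [g x] to
     [x]; both are splices at every level [n >= M]. *)
  apply/seteqP; split; apply: (@context_splice_sub n).
    by move=> z /(gM n Mn)[_]; apply.
  by move=> z /(hM n Mn)[_]; rewrite hg //; apply.
have [baseM memM] := tail_graph_mem encodeM.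
exists (tail_graph (encode x) (encode (g x)) M); split=> // f f'.
rewrite -[f](decodeK hX) -[f'](decodeK hX) !encodeK.
move=> /tail_graph_splice[zx ft].
have [Uf gf] := gM _ (leqnn M) _ zx.
by apply/lc_graphP; split=> //; exact: splice_unique gf ft.
Qed.

End Splicing.

Theorem theorem4p2 (R : realType) (A : finType) (X : set (fullshift A))
  (hX : shift_space X) :
  groupoid_isomorphic (bratteli_groupoid (lc_diagram X)) (lc_groupoid R X).
Proof.
exact: eqrel_groupoid_iso (decodeK hX) (encodeK hX)
  (@decode_reflects_base _ _ hX R) (@encode_reflects_base _ _ hX R).
Qed.
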